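(* For each $1<p<\infty$ there exists $f\in W^{1,p}([0,1])$ such that $$\dim_{A,reg}^\theta(\operatorname{Graph}(f))=1+\frac{\theta}{(1-\theta)p}$$ for all $0<\theta<p/(p+1)$.
   Context: $f\in W^{1,p}([0,1])$ means $f$ is (continuous and) has a weak derivative $f'\in L^p([0,1])$. $\operatorname{Graph}(f)=\{(t,f(t)):t\in[0,1]\}$. For a bounded set $F\subset\mathbb{R}^2$ and $r>0$, $N(F,r)$ is the least number of sets of diameter at most $r$ needed to cover $F$; $D(\mathbf z,R)$ is the closed disc of radius $R$ centered at $\mathbf z$. For $E\subset\mathbb{R}^2$ and $\theta\in(0,1)$, $$\dim_{A,reg}^\theta(E)=\inf\{\gamma>0:\ \exists C>0 \text{ s.t. } N(D(\mathbf z,R)\cap E,r)\le C(R/r)^\gamma \text{ for all } 0<r\le R^{1/\theta}<R<1,\ \mathbf z\in E\}.$$ *)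

(* Defs.v *)
From HB Require Import structures.
From mathcomp Require Import all_boot all_order all_algebra.
From mathcomp Require Import all_classical all_reals all_analysis.
Set Implicit Arguments. Unset Strict Implicit. Unset Printing Implicit Defensive.
Import Order.TTheory GRing.Theory Num.Theory numFieldNormedType.Exports.
Local Open Scope classical_set_scope.
Local Open Scope ring_scope.

Section Defs.
Variable R : realType.

Definition edist (x y : R * R) : R :=
  Num.sqrt ((x.1 - y.1) ^+ 2 + (x.2 - y.2) ^+ 2).

Definition disc (z : R * R) (rho : R) : set (R * R) :=
  [set w | edist z w <= rho].

Definition diam_le (U : set (R * R)) (r : R) : Prop :=
  forall x y, U x -> U y -> edist x y <= r.

Definition covered_by (F : set (R * R)) (r : R) (n : nat) : Prop :=
  exists U : nat -> set (R * R),
    (forall i, (i < n)%N -> diam_le (U i) r) /\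
    (forall x, F x -> exists i, (i < n)%N /\ U i x).

Definition covN (F : set (R * R)) (r : R) : \bar R :=
  ereal_inf [set (n%:R)%:E | n in [set n : nat | covered_by F r n]].

Definition assouad_reg (theta : R) (E : set (R * R)) : \bar R :=
  ereal_inf [set gamma%:E | gamma in
    [set gamma : R | 0 < gamma /\
      exists C : R, 0 < C /\
        forall (r rho : R) (z : R * R),
          0 < r -> 0 < rho -> r <= powR rho theta^-1 -> powR rho theta^-1 < rho ->
          rho < 1 -> E z ->
          (covN (disc z rho `&` E) r <= (C * powR (rho / r) gamma)%:E)%E]].

Definition graph01 (f : R -> R) : set (R * R) :=
  [set w | exists t, 0 <= t <= 1 /\ w = (t, f t)].

Definition test_fun (phi : R -> R) : Prop :=
  (forall (n : nat) (x : R), derivable (derive1n n phi) x 1) /\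
  exists a b : R, 0 < a /\ a <= b /\ b < 1 /\
    forall x, (x < a \/ b < x) -> phi x = 0.

Definition I01 : set R := `]0, 1[.

Definition Lp01 (p : R) (g : R -> R) : Prop :=
  measurable_fun (`]0, 1[ : set R) g /\
  (\int[(@lebesgue_measure R)]_(x in I01) (powR `|g x| p)%:E < +oo)%E.

Definition weak_deriv01 (f g : R -> R) : Prop :=
  forall phi, test_fun phi ->
    Rintegral (@lebesgue_measure R) (`]0, 1[ : set R) (fun x => f x * derive1 phi x) =
    - Rintegral (@lebesgue_measure R) (`]0, 1[ : set R) (fun x => g x * phi x).

Definition W1p01 (p : R) (f : R -> R) : Prop :=
  {within (`[0, 1] : set R), continuous f} /\
  exists g, weak_deriv01 f g /\ Lp01 p g.

End Defs.

(* Main.v *)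
(* With [a = 1/p], the witness is the chirp [f t = t (1 - ln t)^-2 cos (pi t^-a)].
   Its derivative is at most [(3 + pi) t^-a (1 - ln t)^-2] in absolute value, so
   [|f'|^p] is dominated by a multiple of [1 / (t (1 - ln t)^2)], which has the
   bounded antiderivative [1 / (1 - ln t)].

   Upper bound: the variation of [f] on an interval of length [2 R] is
   [O(R^(1-a))], hence [O(R^(1-a) / r)] sets of diameter [r] cover the part of
   the graph in a disc of radius [R], and [R^-a <= (R/r)^(theta/((1-theta)p))]
   as [r <= R^(1/theta)].

   Lower bound: on [[(2i+1)^-p, (2i)^-p]] the chirp runs through all values
   between 0 and its peak at [(2i)^-p]. For [n <= i < 2n], [R = n^-p] and
   [r = R^(1/theta)], the branches are more than [r] apart because
   [1/theta > 1 + a], so that picking on each of them the points at heights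
   [0, 2r, 4r, ...] gives about [n R / r = R^(1-a) / r] points, up to a
   logarithmic factor, with pairwise distances larger than [r]. *)
Require Import Defs.
From HB Require Import structures.
From mathcomp Require Import all_boot all_order all_algebra.
From mathcomp Require Import all_classical all_reals all_analysis.
From mathcomp Require Import measurable_realfun ring lra zify.
Import Order.TTheory GRing.Theory Num.Theory.
Import numFieldNormedType.Exports.
(* MathComp-Analysis has its own [edist]. *)
Import Defs.
Local Open Scope classical_set_scope.
Local Open Scope ring_scope.

Set Implicit Arguments.
Unset Strict Implicit.

(** * The chirp and its classical derivative *)

(** This weight is an antiderivative of [logw t ^+ 2 / t] and stays bounded near 0, which is what
    makes [|f'|^p] integrable there. *)
Definition logw {R : realType} (t : R) : R := (1 - ln t)^-1.

Definition chirp {R : realType} (p t : R) : R :=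
  t * logw t ^+ 2 * cos (pi * t `^ (- p^-1)).

Definition chirp' {R : realType} (p t : R) : R :=
  (logw t ^+ 2 + 2 * logw t ^+ 3) * cos (pi * t `^ (- p^-1))
  + pi * p^-1 * t `^ (- p^-1) * logw t ^+ 2 * sin (pi * t `^ (- p^-1)).

Lemma is_derive_logw {R : realType} (t : R) :
  0 < t -> ln t < 1 -> is_derive t 1 logw (logw t ^+ 2 / t).
Proof.
move=> t0 t1; have l0 : 1 - ln t != 0 by rewrite gt_eqF// subr_gt0.
have d1 : is_derive t 1 (fun x : R => 1 - ln x) (- t^-1).
  by have := is_deriveB (is_derive_cst (1 : R) t 1) (is_derive1_ln t0); rewrite sub0r.
apply: is_derive_eq; first exact: (@is_deriveV R (fun x => 1 - ln x) t _ 1 l0 d1).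
by rewrite /logw /GRing.scale/= mulrN mulNr opprK exprVn.
Qed.

Lemma is_derive_chirp {R : realType} (p t : R) :
  0 < t -> ln t < 1 -> is_derive t 1 (chirp p) (chirp' p t).
Proof.
move=> t0 t1.
have da := is_deriveM (is_derive_id t 1) (is_deriveX 2 (is_derive_logw t0 t1)).
have dp := is_deriveM (is_derive_cst (pi : R) t 1) (@is_derive1_powR R (- p^-1) t t0).
have dc := is_deriveM da (is_derive1_comp (is_derive_cos _) dp).
apply: (@is_derive_eq _ _ _ (chirp p) t 1 _ _ dc).
rewrite /GRing.scale/= /chirp' !fctE/=.
have -> : t `^ (- p^-1 - 1) = t `^ (- p^-1) / t.
  by rewrite powRB ?powRr1 ?ltW// (gt_eqF t0) implybT.
by move: (p^-1) => q; field; rewrite gt_eqF.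
Qed.

(** * Classical derivatives as weak derivatives *)

Lemma derive1_eq0_near {R : realType} (f : R -> R) (x : R) :
  (\forall y \near x, f y = 0) -> derive1 f x = 0.
Proof.
move=> fx; rewrite derive1E (near_eq_derive _ _ (g := cst 0)) ?derive_cst//.
Qed.

(** Serves to move integrals against a test function from the open unit interval to a compact
    subinterval. *)
Lemma Rintegral_supported {R : realType} (A B : set R) (f : R -> R) :
  (B `<=` A)%classic -> (forall x, A x -> ~ B x -> f x = 0) ->
  (\int[lebesgue_measure]_(x in A) f x = \int[lebesgue_measure]_(x in B) f x)%R.
Proof.
move=> BA f0; rewrite Rintegral_mkcond [RHS]Rintegral_mkcond.
congr (Rintegral _ _ _); apply/funext => x; rewrite !patchE.
have [xA|xA] := boolP (x \in A).
  have [//|xB] := boolP (x \in B).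
  by rewrite f0//; [rewrite inE in xA|rewrite notin_setE in xB].
rewrite ifN// notin_setE => /BA; rewrite notin_setE in xA; exact: xA.
Qed.

(** A test function lives on a compact part of the open interval, where [f] is C^1, so ordinary
    integration by parts applies and its boundary terms vanish. *)
Lemma weak_deriv01_C1 {R : realType} (f f' : R -> R) :
  (forall t : R, 0 < t < 1 -> is_derive t 1 f (f' t)) ->
  (forall t : R, 0 < t < 1 -> {for t, continuous f'}) ->
  weak_deriv01 f f'.
Proof.
move=> df cf' phi [dphi [a [b [a0 [ab [b1 phi0]]]]]].
have cderiv (g : R -> R) t : derivable g t 1 -> {for t, continuous g}.
  by move=> /derivable1_diffP/differentiable_continuous.
have [dphi0 dphi1] := (dphi 0%N, dphi 1%N).
have cphi t : {for t, continuous phi} by exact/cderiv/dphi0.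
have cphi' t : {for t, continuous (derive1 phi)} by exact/cderiv/dphi1.
have phi'0 x : x < a \/ b < x -> derive1 phi x = 0.
  move=> [xa|bx]; apply: derive1_eq0_near.
    by near=> y; apply: phi0; left; near: y; exact: lt_nbhsl.
  by near=> y; apply: phi0; right; near: y; exact: lt_nbhsr.
(* [[c, d]] lies inside the open unit interval, so [f] is C^1 up to its ends, and it exceeds
   [[a, b]] strictly on both sides, so [phi] vanishes at [c] and [d]. *)
pose c := a / 2; pose d := (b + 1) / 2.
have [c0 ca bd d1] : [/\ 0 < c, c < a, b < d & d < 1] by rewrite /c /d; split; lra.
have cd01 t : c <= t <= d -> 0 < t < 1 by move=> /andP[? ?]; apply/andP; split; lra.
have cdI : (`[c, d] `<=` @I01 R)%classic.
  by move=> x /=; rewrite !in_itv/=; exact: cd01.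
have out x : ~ (`[c, d]%classic x) -> x < a \/ b < x.
  rewrite /= in_itv/= => /negP; rewrite negb_and -!ltNge => /orP[]?; [left|right]; lra.
have cf t : 0 < t < 1 -> {for t, continuous f}.
  by move=> t01; apply: cderiv; have [] := df t t01.
have LR (g : R -> R) : (forall t : R, 0 < t < 1 -> derivable g t 1) ->
    derivable_oo_LRcontinuous g c d.
  move=> dg; split.
  - by move=> x; rewrite in_itv/= => /andP[? ?]; apply/dg/cd01; rewrite !ltW.
  - by apply: cvg_at_right_filter; apply/cderiv/dg; apply/cd01; rewrite lexx/=; lra.
  - by apply: cvg_at_left_filter; apply/cderiv/dg; apply/cd01; rewrite lexx andbT; lra.
rewrite (Rintegral_supported cdI); last first.
  by move=> x _ /out /phi'0 ->; rewrite mulr0.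
rewrite [in RHS](Rintegral_supported cdI); last first.
  by move=> x _ /out /phi0 ->; rewrite mulr0.
rewrite (@Rintegration_by_parts R f phi f' (derive1 phi)).
- by rewrite !phi0; [rewrite !mulr0 subr0 sub0r|left; lra|right; lra].
- lra.
- apply: continuous_in_subspaceT => x; rewrite inE/= in_itv/= => /cd01; exact: cf'.
- by apply: LR => t /df [].
- move=> x; rewrite in_itv/= => /andP[? ?].
  have /cd01/df[_ dfE] : c <= x <= d by rewrite !ltW.
  by rewrite derive1E dfE.
- apply: continuous_in_subspaceT => x _; exact: cphi'.
- by apply: LR => t _; exact: dphi0.
- by [].
Unshelve. all: by end_near. Qed.

(** * Pointwise bounds and continuity of the chirp *)

Lemma logw_bounds {R : realType} (t : R) : 0 < t <= 1 -> 0 < logw t <= 1.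
Proof.
move=> /andP[t0 t1]; have l0 : ln t <= 0 by exact: ln_le0.
rewrite /logw invr_gt0 subr_gt0 (le_lt_trans l0)//=.
by rewrite invf_le1 ?lerBrDr ?gerDl// subr_gt0 (le_lt_trans l0).
Qed.

Lemma powRN_ge1 {R : realType} (t a : R) : 0 < t <= 1 -> 0 <= a -> 1 <= t `^ (- a).
Proof.
by move=> t01 a0; rewrite -[leLHS](powRr0 t) ger_powR// oppr_le0.
Qed.

(** With [s = t^(-1/p) >= 1] and [0 < w <= 1], the cosine coefficient is at most [3 w^2 <= 3 s w^2],
    and the sine coefficient at most [pi s w^2] because [1/p <= 1]. *)
Lemma chirp'_le {R : realType} (p t : R) : 1 < p -> 0 < t <= 1 ->
  `|chirp' p t| <= (3 + pi) * (t `^ (- p^-1) * logw t ^+ 2).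
Proof.
move=> p1 t01; have /andP[w0 w1] := logw_bounds t01.
have p0 : 0 <= p^-1 by rewrite invr_ge0; lra.
have p1' : p^-1 <= 1 by rewrite invf_le1; lra.
have pi0 := pi_gt0 R.
have s1 := powRN_ge1 t01 p0.
rewrite /chirp'; set s := t `^ _ in s1 *; set w := logw t in w0 w1 *.
apply: (le_trans (ler_normD _ _)); rewrite !normrM.
rewrite (ger0_norm (ltW pi0)) (ger0_norm p0) (@ger0_norm _ s) ?(le_trans _ s1)//.
rewrite [`|w|]ger0_norm ?(ltW w0)// -?expr2 [`|w ^+ 2 + _|]ger0_norm; last first.
  by rewrite addr_ge0 ?mulr_ge0 ?exprn_ge0// ltW.
have c1 : `|cos (pi * s)| <= 1 by rewrite ler_norml cos_geN1 cos_le1.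
have c2 : `|sin (pi * s)| <= 1 by rewrite ler_norml sin_geN1 sin_le1.
have w2 : 0 <= w ^+ 2 by exact: sqr_ge0.
have w3 : w ^+ 3 <= w ^+ 2 by rewrite exprS ler_piMl.
have ws : w ^+ 2 <= s * w ^+ 2 by rewrite ler_peMl.
have b1 : (w ^+ 2 + 2 * w ^+ 3) * `|cos (pi * s)| <= 3 * (s * w ^+ 2).
  apply: (@le_trans _ _ (w ^+ 2 + 2 * w ^+ 3)); last lra.
  by rewrite ler_piMr// addr_ge0 ?mulr_ge0 ?exprn_ge0// ltW.
have b2 : pi * p^-1 * s * w ^+ 2 * `|sin (pi * s)| <= pi * (s * w ^+ 2).
  have sw : 0 <= s * w ^+ 2 by rewrite mulr_ge0// (le_trans _ s1).
  rewrite [leLHS](_ : _ = pi * (p^-1 * `|sin (pi * s)| * (s * w ^+ 2))); last by ring.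
  by rewrite ler_wpM2l ?(ltW pi0)// ler_piMl// mulr_ile1.
lra.
Qed.

Lemma continuous_chirp' {R : realType} (p t : R) :
  0 < t < 1 -> {for t, continuous (chirp' p)}.
Proof.
move=> /andP[t0 t1].
have l1 : ln t < 1 by rewrite (le_lt_trans (ln_le0 (ltW t1))).
have cw : {for t, continuous logw}.
  have [dw _] := is_derive_logw t0 l1.
  exact/differentiable_continuous/derivable1_diffP.
have cp : {for t, continuous (@powR R ^~ (- p^-1))}.
  have [dp _] := @is_derive1_powR R (- p^-1) t t0.
  exact/differentiable_continuous/derivable1_diffP.
have cpp : {for t, continuous (fun x => pi * x `^ (- p^-1))}.
  by apply: continuousM => //; exact: cst_continuous.
have cX n : {for t, continuous (fun x => logw x ^+ n)}.
  exact: (continuous_comp cw (@exprn_continuous R n _)).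
have c3 : {for t, continuous (fun x => logw x ^+ 2 + 2 * logw x ^+ 3)}.
  apply: (@continuousD _ _ _ (fun x => logw x ^+ 2)); first exact: cX.
  by apply: (@continuousM _ _ (fun=> 2)) => //; exact: cst_continuous.
have ccos : {for t, continuous (fun x => cos (pi * x `^ (- p^-1)))}.
  by apply: (continuous_comp cpp); exact: continuous_cos.
have csin : {for t, continuous (fun x => sin (pi * x `^ (- p^-1)))}.
  by apply: (continuous_comp cpp); exact: continuous_sin.
apply: continuousD; first exact: continuousM c3 ccos.
apply: continuousM csin; apply: continuousM; last exact: cX.
by apply: continuousM => //; exact: cst_continuous.
Qed.

Lemma chirp0 {R : realType} (p : R) : chirp p 0 = 0.
Proof. by rewrite /chirp !mul0r. Qed.

Lemma chirp_le {R : realType} (p t : R) : 0 <= t <= 1 -> `|chirp p t| <= t.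
Proof.
move=> /andP[]; rewrite le_eqVlt => /predU1P[<- _|t0 t1]; first by rewrite chirp0 normr0.
have /andP[w0 w1] : 0 < logw t <= 1 by rewrite logw_bounds// t0 t1.
rewrite /chirp !normrM (gtr0_norm t0) (gtr0_norm w0) -mulrA ler_piMr ?(ltW t0)//.
by rewrite !mulr_ile1 ?mulr_ge0 ?(ltW w0)// ler_norml cos_geN1 cos_le1.
Qed.

Lemma ln_lt1 {R : realType} (t : R) : t <= 1 -> ln t < 1.
Proof. by move=> /ln_le0 /le_lt_trans; apply. Qed.

Lemma continuous_chirp {R : realType} (p : R) :
  {within `[0, 1]%classic, continuous (chirp p)}.
Proof.
apply/subspace_continuousP => t /=; rewrite in_itv/= => /andP[+ t1].
(* Away from 0 the chirp is differentiable; at 0 it is squeezed by [|chirp p x| <= x]. *)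
rewrite le_eqVlt => /predU1P[<-|t0]; last first.
  apply: cvg_within_filter.
  have [dt _] := is_derive_chirp p t0 (ln_lt1 t1).
  exact/differentiable_continuous/derivable1_diffP.
rewrite [X in _ --> X]chirp0; apply/cvgr0Pnorm_lt => e e0; rewrite near_withinE.
near=> x => /=; rewrite in_itv/= => x01.
apply: (le_lt_trans (chirp_le p x01)); near: x; exact: lt_nbhsl.
Unshelve. all: by end_near. Qed.

(** * Integrability of the derivative and Sobolev membership *)

Lemma continuous_logw {R : realType} (x : R) :
  0 < x <= 1 -> {for x, continuous (@logw R)}.
Proof.
move=> /andP[x0 /ln_lt1 x1]; have [dw _] := is_derive_logw x0 x1.
exact/differentiable_continuous/derivable1_diffP.
Qed.

Lemma continuous_logw2_div {R : realType} (x : R) :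
  0 < x <= 1 -> {for x, continuous (fun x => logw x ^+ 2 / x)}.
Proof.
move=> x01; have cw := continuous_logw x01.
have cw2 : {for x, continuous (fun x => logw x ^+ 2)}.
  exact: (continuous_comp cw (@exprn_continuous R 2 _)).
apply: (continuousM cw2); apply: cvgV => //.
by case/andP: x01 => x0 _; rewrite gt_eqF.
Qed.

(** On [[1/(n+2), 1]] the fundamental theorem of calculus gives an increment of [logw], which is at
    most 1; monotone convergence carries the bound to the union of these intervals. *)
Lemma integral_logw2_lty {R : realType} :
  (\int[@lebesgue_measure R]_(x in @I01 R) (logw x ^+ 2 / x)%:E < +oo)%E.
Proof.
pose f (x : R) : \bar R := (logw x ^+ 2 / x)%:E.
(* Starting from [n.+2] keeps the interval nondegenerate for every [n]. *)
pose F n : set R := `[n.+2%:R^-1, 1]%classic.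
have F01 n x : F n x -> 0 < x <= 1.
  by rewrite /F/= in_itv/= => /andP[+ ->]; rewrite andbT; apply: lt_le_trans.
have a0 n : (0 : R) < n.+2%:R^-1 by rewrite invr_gt0.
have a1 n : n.+2%:R^-1 < 1 :> R by rewrite invf_lt1// ltr1n.
have mw n : measurable_fun (F n) (fun x => logw x ^+ 2 / x).
  apply: subspace_continuous_measurable_fun; first exact: measurable_itv.
  by apply: continuous_in_subspaceT => x; rewrite inE => /F01;
    exact: continuous_logw2_div.
have mf n : measurable_fun (F n) f by exact/measurable_EFinP.
have intF n : (\int[lebesgue_measure]_(x in F n) f x <= 1)%E.
  rewrite /f /F (@continuous_FTC2 _ _ logw) => //.
  - rewrite -EFinB lee_fin lerBlDr; have /andP[w0 _] : 0 < logw (n.+2%:R^-1 : R) <= 1.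
      by rewrite logw_bounds// a0 ltW.
    have /andP[_ w1] : 0 < logw (1 : R) <= 1 by rewrite logw_bounds// ltr01 lexx.
    by rewrite (le_trans w1)// lerDl ltW.
  - by apply: continuous_in_subspaceT => x; rewrite inE => /F01;
    exact: continuous_logw2_div.
  - split.
    + move=> x; rewrite in_itv/= => /andP[nx x1].
      by have [] := is_derive_logw (lt_trans (a0 n) nx) (ln_lt1 (ltW x1)).
    + by apply: cvg_at_right_filter; apply: continuous_logw; rewrite a0 ltW.
    + by apply: cvg_at_left_filter; apply: continuous_logw; rewrite ltr01 lexx.
  - move=> x; rewrite in_itv/= => /andP[nx x1].
    have [_ dE] := is_derive_logw (lt_trans (a0 n) nx) (ln_lt1 (ltW x1)).
    by rewrite derive1E dE.
have ndF : nondecreasing_seq F.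
  move=> m n mn; apply/subsetPset => x; rewrite /F/= !in_itv/= => /andP[+ ->].
  rewrite andbT; apply: le_trans; rewrite lef_pV2 ?posrE// ler_nat; lia.
have f0 n x : F n x -> (0 <= f x)%E.
  by move=> /F01/andP[x0 _]; rewrite lee_fin divr_ge0 ?sqr_ge0// ltW.
have mF n : measurable (F n) by exact: measurable_itv.
have cvgF : (fun i => \int[lebesgue_measure]_(x in F i) f x)%E @ \oo -->
    (\int[lebesgue_measure]_(x in \bigcup_i F i) f x)%E.
  exact: ge0_nondecreasing_set_cvg_integral.
have le1 : (\int[lebesgue_measure]_(x in \bigcup_i F i) f x <= 1)%E.
  rewrite -(cvg_lim _ cvgF)//; apply: lime_le.
    by apply/cvg_ex; eexists; exact: cvgF.
  by near=> n; exact: intF.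
apply: le_lt_trans (ltry 1); apply: le_trans le1.
have IF : (@I01 R `<=` \bigcup_i F i)%classic.
  move=> x; rewrite /I01/= in_itv/= => /andP[x0 x1].
  exists (Num.truncn x^-1) => //; rewrite /F/= in_itv/= (ltW x1) andbT.
  rewrite invf_ple ?posrE// ltW// (lt_trans (truncnS_gt _))// ltr_nat//.
apply: ge0_subset_integral => //.
- exact: measurable_itv.
- by apply: bigcup_measurable => n _; exact: mF.
- exact/(measurable_fun_bigcup _ mF).
- by move=> x [n _]; exact: f0.
Unshelve. all: by end_near. Qed.

(** Raising the pointwise bound to the power [p] turns [x^(-1/p)] into [1/x], and [(w^2)^p <= w^2]
    since [w^2 <= 1 < p]; the integrand is thus at most [(3 + pi)^p w^2 / x]. *)
Lemma Lp01_chirp' {R : realType} (p : R) : 1 < p -> Lp01 p (chirp' p).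
Proof.
move=> p1; have p0 : 0 < p by lra.
have mg : measurable_fun (`]0, 1[%classic : set R) (chirp' p).
  apply: open_continuous_measurable_fun; first exact: interval_open.
  by move=> x; rewrite inE; exact: continuous_chirp'.
split => //.
pose K := (3 + pi : R) `^ p.
have K0 : 0 <= K by exact: powR_ge0.
have w0 x : 0 < x < 1 -> (0 <= logw x ^+ 2 / x :> R).
  by move=> /andP[x0 _]; rewrite divr_ge0 ?sqr_ge0// ltW.
have mw : measurable_fun (@I01 R) (fun x => logw x ^+ 2 / x).
  apply: open_continuous_measurable_fun; first exact: interval_open.
  move=> x; rewrite inE /I01/= in_itv/= => /andP[x0 x1].
  by apply: continuous_logw2_div; rewrite x0 ltW.
apply: (@le_lt_trans _ _
    (K%:E * \int[lebesgue_measure]_(x in @I01 R) (logw x ^+ 2 / x)%:E)%E).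
  rewrite -ge0_integralZl_EFin//; first last.
  - exact/measurable_EFinP.
  - exact: measurable_itv.
  apply: ge0_le_integral => //=.
  - exact: measurable_itv.
  - apply/measurable_EFinP; apply: (measurableT_comp (measurable_powR p)).
    exact: measurableT_comp.
  - by apply/measurable_EFinP; exact: measurable_funM.
  - move=> x; rewrite /I01/= in_itv/= => x01; have /andP[x0 x1] := x01.
    have x01' : 0 < x <= 1 by rewrite x0 ltW.
    have /andP[v0 v1] := logw_bounds x01'.
    rewrite -EFinM lee_fin; have := chirp'_le p1 x01'.
    have pi0 := pi_gt0 R.
    have a0 := powR_ge0 x (- p^-1).
    have k0 : 0 <= 3 + pi :> R by lra.
    have u0 : 0 <= x `^ (- p^-1) * logw x ^+ 2 by rewrite mulr_ge0 ?sqr_ge0.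
    move=> /(ge0_ler_powR (ltW p0)).
    rewrite !nnegrE => /(_ (normr_ge0 _) (mulr_ge0 k0 u0)) /le_trans; apply.
    rewrite (powRM _ k0 u0) -/K ler_wpM2l// (powRM _ a0 (sqr_ge0 _)).
    rewrite -powRrM mulNr mulVf ?gt_eqF// (powR_inv1 (ltW x0)).
    rewrite [leRHS]mulrC ler_wpM2l ?invr_ge0 ?(ltW x0)// ge1r_powR ?(ltW p1)//.
    by rewrite exprn_gt0//= exprn_ile1// ltW.
by apply: lte_mul_pinfty => //; exact: integral_logw2_lty.
Qed.

Lemma W1p01_chirp {R : realType} (p : R) : 1 < p -> W1p01 p (chirp p).
Proof.
move=> p1; split; first exact: continuous_chirp.
exists (chirp' p); split; last exact: Lp01_chirp'.
apply: weak_deriv01_C1 => t t01; last exact: continuous_chirp'.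
by case/andP: t01 => t0 t1; apply: is_derive_chirp => //; exact/ln_lt1/ltW.
Qed.

(** * Upper bound: covering the graph inside a disc *)

Lemma normB1_le_edist {R : realType} (x y : R * R) : `|x.1 - y.1| <= edist x y.
Proof. by rewrite -sqrtr_sqr ler_wsqrtr// lerDl sqr_ge0. Qed.

Lemma normB2_le_edist {R : realType} (x y : R * R) : `|x.2 - y.2| <= edist x y.
Proof. by rewrite -sqrtr_sqr ler_wsqrtr// lerDr sqr_ge0. Qed.

Lemma edist_le_add {R : realType} (x y : R * R) :
  edist x y <= `|x.1 - y.1| + `|x.2 - y.2|.
Proof.
have S0 : 0 <= `|x.1 - y.1| + `|x.2 - y.2| by rewrite addr_ge0.
rewrite -[leRHS]ger0_norm// -sqrtr_sqr ler_wsqrtr//.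
rewrite -(real_normK (num_real (x.1 - y.1))) -(real_normK (num_real (x.2 - y.2))).
by rewrite sqrrD lerD2r lerDl mulrn_wge0// mulr_ge0.
Qed.

(** The key [k] is a real coordinate on [F] whose increments dominate distances. Cutting [[0, M]]
    into cells of length [r] and pulling them back along [k] gives sets of diameter at most [r]. *)
Lemma covN_le_key {R : realType} (F : set (R * R)) (k : R * R -> R) (r M : R) :
  0 < r -> 0 <= M -> (forall w, F w -> 0 <= k w <= M) ->
  (forall w w', F w -> F w' ->
    `|w.1 - w'.1| + `|w.2 - w'.2| <= `|k w - k w'|) ->
  (covN F r <= (M / r + 1)%:E)%E.
Proof.
move=> r0 M0 kM kF.
pose lev w := Num.truncn (k w / r).
apply: (@le_trans _ _ ((Num.truncn (M / r)).+1%:R)%:E); last first.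
  by rewrite lee_fin -natr1 lerD2r truncn_le// divr_ge0// ltW.
apply: ereal_inf_lbound; exists (Num.truncn (M / r)).+1 => //.
exists (fun i => F `&` [set w | lev w = i]); split.
  move=> i _ w w' [Fw lw] [Fw' lw'].
  apply: (le_trans (edist_le_add _ _)); apply: (le_trans (kF _ _ Fw Fw')).
  have lev_itv v : F v -> (lev v)%:R <= k v / r < (lev v).+1%:R.
    by move=> /kM/andP[k0 _]; rewrite truncn_itv// divr_ge0// ltW.
  have := lev_itv _ Fw; have := lev_itv _ Fw'.
  rewrite lw lw' -natr1 => /andP[a b] /andP[c d].
  have : `|k w / r - k w' / r| <= 1 by rewrite ler_norml; apply/andP; split; lra.
  by rewrite -mulrBl normrM normfV (gtr0_norm r0) ler_pdivrMr// mul1r.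
move=> w Fw; exists (lev w); split => //; rewrite ltnS.
have /andP[_ kw] := kM _ Fw.
by apply: le_truncn; rewrite ler_pM2r ?invr_gt0.
Qed.

(** For [0 < u <= x + y] the ratio [u / (x + y)] is at most its own power [q], as [q <= 1]. Adding
    the cases [u = x] and [u = y] gives the claim. *)
Lemma powR_subadd {R : realType} (q x y : R) : 0 <= q <= 1 -> 0 <= x -> 0 <= y ->
  (x + y) `^ q <= x `^ q + y `^ q.
Proof.
move=> /andP[q0 q1]; rewrite le_eqVlt => /predU1P[<- _|x0].
  by rewrite add0r lerDr powR_ge0.
rewrite le_eqVlt => /predU1P[<-|y0]; first by rewrite addr0 lerDl powR_ge0.
have s0 : 0 < x + y by rewrite addr_gt0.
have H u : 0 < u <= x + y -> u / (x + y) * (x + y) `^ q <= u `^ q.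
  move=> /andP[u0 us].
  have -> : u `^ q = (u / (x + y)) `^ q * (x + y) `^ q.
    by rewrite -powRM ?divfK ?gt_eqF// ?divr_ge0// ltW.
  rewrite ler_wpM2r ?powR_ge0// ger1_powR// divr_gt0//= ler_pdivrMr// mul1r//.
have := lerD (H x _) (H y _); rewrite -mulrDl -mulrDl divff ?gt_eqF// mul1r.
apply; apply/andP; split => //; lra.
Qed.

Lemma chirp_variation {R : realType} (p s t : R) : 1 < p -> 0 <= s -> s <= t -> t <= 1 ->
  `|chirp p t - chirp p s| <=
    (3 + pi) / (1 - p^-1) * (t `^ (1 - p^-1) - s `^ (1 - p^-1)).
Proof.
move=> p1; have p0 : 0 < p by lra.
have q0 : 0 < 1 - p^-1 by rewrite subr_gt0 invf_lt1.
have q1 : 1 - p^-1 <= 1 by rewrite lerBlDr lerDl invr_ge0 ltW.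
set q := 1 - p^-1 in q0 q1 *; set K := (3 + pi) / q.
have pi0 := pi_gt0 R.
have Kq : K * q = 3 + pi by rewrite /K divfK// gt_eqF.
have K1 : 1 <= K by rewrite /K ler_pdivlMr// mul1r; lra.
rewrite le_eqVlt => /predU1P[<- t0 t1|s0 st t1].
  rewrite chirp0 subr0 (@powR0 _ q) ?gt_eqF// subr0.
  apply: (@le_trans _ _ t); first by apply: chirp_le; rewrite t0.
  move: t0; rewrite le_eqVlt => /predU1P[<-|t0]; first by rewrite powR0 ?mulr0// gt_eqF.
  apply: (@le_trans _ _ (t `^ q)); first by rewrite ger1_powR// t0.
  by rewrite ler_peMl// powR_ge0.
have in01 x : x \in `[s, t]%R -> 0 < x <= 1.
  by rewrite in_itv/= => /andP[sx xt]; rewrite (lt_le_trans s0)//= (le_trans xt).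
have dfx (e x : R) : x \in `[s, t]%R ->
    is_derive x 1 (fun y => K * y `^ q + e * chirp p y)
      ((3 + pi) * x `^ (- p^-1) + e * chirp' p x).
  move=> /in01/andP[x0 x1].
  have d1 := is_deriveM (is_derive_cst K x 1) (@is_derive1_powR R q x x0).
  have d2 := is_deriveM (is_derive_cst e x 1) (is_derive_chirp p x0 (ln_lt1 x1)).
  apply: (@is_derive_eq _ _ _ _ _ _ _ _ (is_deriveD d1 d2)).
  rewrite /GRing.scale/= !mulr0 !addr0 mulrA Kq.
  by rewrite /q [1 - p^-1]addrC addrK.
(* Used with the signs [e = 1] and [e = -1], which bound the increment from both sides. *)
have nd (e : R) : `|e| = 1 ->
    K * s `^ q + e * chirp p s <= K * t `^ q + e * chirp p t.
  move=> e1.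
  apply: (@ger0_derive1_ndecr _ (fun y => K * y `^ q + e * chirp p y) s t).
  - by move=> x /subset_itv_oo_cc /(dfx e) [].
  - move=> x /subset_itv_oo_cc xst; have [_ dE] := dfx e x xst.
    rewrite derive1E dE; have x01 := in01 _ xst.
    have := chirp'_le p1 x01; have /andP[w0 w1] := logw_bounds x01.
    have v0 := powR_ge0 x (- p^-1).
    have : (3 + pi) * (x `^ (- p^-1) * logw x ^+ 2) <= (3 + pi) * x `^ (- p^-1).
      rewrite ler_wpM2l//; first lra.
      by rewrite ler_piMr// exprn_ile1// ltW.
    have : - `|chirp' p x| <= e * chirp' p x.
      by rewrite -[`|chirp' p x|]mul1r -e1 -normrM -lerN2 opprK -normrN ler_norm.
    lra.
  - by apply: derivable_within_continuous => x /(dfx e) [].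
  - exact: lexx.
  - exact: st.
  - exact: lexx.
have := nd 1 (normr1 _); have := nd (-1) (normrN1 _).
rewrite mulrBr ler_norml => ? ?; apply/andP; split; lra.
Qed.

Lemma chirp_covN_le {R : realType} (p theta : R) : 1 < p -> 0 < theta < 1 ->
  exists C : R, 0 < C /\
    forall (r rho : R) (z : R * R),
      0 < r -> 0 < rho -> r <= rho `^ theta^-1 -> rho `^ theta^-1 < rho ->
      rho < 1 -> graph01 (chirp p) z ->
      (covN (disc z rho `&` graph01 (chirp p)) r <=
        (C * (rho / r) `^ (1 + theta / ((1 - theta) * p)))%:E)%E.
Proof.
move=> p1 /andP[th0 th1]; have p0 : 0 < p by lra.
have q0 : 0 < 1 - p^-1 by rewrite subr_gt0 invf_lt1.
have q1 : 1 - p^-1 <= 1 by rewrite lerBlDr lerDl invr_ge0 ltW.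
set K := (3 + pi) / (1 - p^-1).
have K0 : 0 < K by rewrite divr_gt0// addr_gt0// pi_gt0.
have vf (s t : R) : 0 <= s -> s <= t -> t <= 1 ->
    `|chirp p t - chirp p s| <= K * (t `^ (1 - p^-1) - s `^ (1 - p^-1)).
  exact: chirp_variation.
(* [2] pays for the width of the disc, [2 K] for the variation of the chirp, and the remaining [1]
   for the extra set due to rounding, all measured against [rho / r * rho^(-1/p)]. *)
exists (3 + 2 * K); split; first by rewrite addr_gt0// mulr_gt0.
move=> r rho z r0 rho0 rle rholt rho1 [t0 [/andP[t00 t01] ->]].
set q := 1 - p^-1 in q0 q1 vf *.
pose a := Num.max 0 (t0 - rho).
have a0 : 0 <= a by rewrite le_max lexx.
(* The first summand measures horizontal displacement from the left end [a], the second bounds the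
   variation of the chirp since [a]; their sum is the key for the covering. *)
pose k (w : R * R) := (w.1 - a) + K * (w.1 `^ q - a `^ q).
have Fw (w : R * R) : (disc (t0, chirp p t0) rho `&` graph01 (chirp p)) w ->
    [/\ a <= w.1, w.1 - a <= 2 * rho, w.1 <= 1 & w.2 = chirp p w.1].
  move=> [dw [t [/andP[t0' t1] ?]]]; subst w => /=.
  have := le_trans (normB1_le_edist _ _) dw; rewrite /= ler_norml => /andP[h1 h2].
  split => //; first by rewrite ge_max t0'/=; lra.
  suff : t0 - rho <= a by lra.
  by rewrite le_max lexx orbT.
have powle (x y : R) : 0 <= x -> x <= y -> x `^ q <= y `^ q.
  by move=> x0 xy; rewrite ge0_ler_powR ?nnegrE ?(ltW q0)// (le_trans x0).
apply: (le_trans (@covN_le_key _ _ k r (2 * rho + 2 * K * rho `^ q) r0 _ _ _)).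
- have := powR_ge0 rho q; have : 0 <= 2 * rho by lra.
  by move=> ? ?; rewrite addr_ge0// mulr_ge0// mulr_ge0// ltW.
- move=> w /Fw[aw wa w1 _]; rewrite /k; apply/andP; split.
    by rewrite addr_ge0 ?subr_ge0// mulr_ge0 ?(ltW K0)// subr_ge0 powle.
  rewrite lerD// -mulrA mulrCA ler_wpM2l ?(ltW K0)//.
  (* Subadditivity is used twice: [w.1^q - a^q <= (w.1 - a)^q <= (2 rho)^q <= 2 rho^q]. *)
  have := @powR_subadd _ q (w.1 - a) a; rewrite subrK (ltW q0) q1 a0 subr_ge0.
  move=> /(_ isT aw isT) h; have : (w.1 - a) `^ q <= (rho + rho) `^ q.
    by apply: powle; lra.
  have := @powR_subadd _ q rho rho; rewrite (ltW q0) q1 (ltW rho0) => /(_ isT isT isT).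
  lra.
- move=> w w' /Fw[aw _ w1 wE] /Fw[aw' _ w1' wE'].
  wlog : w w' aw w1 wE aw' w1' wE' / w'.1 <= w.1 => [H|ww'].
    have [/H|/ltW/H] := leP w'.1 w.1; first exact.
    by rewrite (distrC w'.1) (distrC w'.2) (distrC (k w')); apply.
  have w'0 := le_trans a0 aw'.
  have := vf _ _ w'0 ww' w1; rewrite -wE -wE' => h.
  apply: le_trans (ler_norm _); rewrite /k ger0_norm ?subr_ge0//; lra.
rewrite lee_fin.
set g := 1 + _.
have r1 : 1 <= rho / r by rewrite ler_pdivlMr// mul1r (le_trans rle)// ltW.
have qE : rho `^ q = rho * rho `^ (- p^-1).
  by rewrite /q powRD ?powRr1 ?ltW// (gt_eqF rho0) implybT.
have v1 : 1 <= rho `^ (- p^-1).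
  by apply: powRN_ge1; rewrite ?rho0 ?invr_ge0 ltW.
(* Here the exponent arises: [rho^(-1/p)] is the power [theta / ((1 - theta) p)] of
   [rho^(1 - 1/theta)], and the latter is at most [rho / r] because [r <= rho^(1/theta)]. *)
have main : rho / r * rho `^ (- p^-1) <= (rho / r) `^ g.
  rewrite /g powRD ?(gt_eqF (lt_le_trans ltr01 r1)) ?implybT//.
  rewrite powRr1 ?(le_trans ler01)// ler_wpM2l ?(le_trans ler01)//.
  have -> : - p^-1 = (1 - theta^-1) * (theta / ((1 - theta) * p)).
    by field; rewrite !gt_eqF// subr_gt0.
  have d0 : 0 <= theta / ((1 - theta) * p).
    by rewrite divr_ge0 ?mulr_ge0 ?subr_ge0// ltW.
  have b0 : rho `^ (1 - theta^-1) <= rho / r.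
    rewrite powRB ?(gt_eqF rho0) ?implybT// powRr1 ?(ltW rho0)//.
    by rewrite ler_wpM2l ?(ltW rho0)// lef_pV2 ?posrE// powR_gt0.
  by rewrite (powRrM rho) (ge0_ler_powR d0)// nnegrE ?powR_ge0// (le_trans ler01).
apply: le_trans (ler_wpM2l _ main); last by rewrite addr_ge0// mulr_ge0// ltW.
set v := rho `^ (- p^-1) in v1 qE *; rewrite qE.
have -> : (2 * rho + 2 * K * (rho * v)) / r + 1 =
  2 * (rho / r) + 2 * K * (rho / r * v) + 1 by ring.
have : rho / r <= rho / r * v by rewrite ler_peMr// (le_trans ler01).
lra.
Qed.

(** * Lower bound: separated points on the branches *)

(** A set of diameter at most [r] contains at most one of the points, so sending each point to a
    covering set that contains it is injective. *)
Lemma covN_ge_separated {R : realType} (I : finType) (P : I -> R * R)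
    (F : set (R * R)) (r : R) :
  (forall i, F (P i)) -> (forall i j, i != j -> r < edist (P i) (P j)) ->
  ((#|I|%:R)%:E <= covN F r)%E.
Proof.
move=> FP sepP; apply/ereal_infP => _ [n [U [dU cU]] <-].
rewrite lee_fin ler_nat -[n]card_ord.
have /choice[g gP] : forall i, exists j : 'I_n, U j (P i).
  by move=> i; have [j [jn Uj]] := cU _ (FP i); exists (Ordinal jn).
apply: (@leq_card _ _ g) => i j gij; apply/eqP; apply: contraT => /sepP.
have Uj : U (g i) (P j) by rewrite gij; exact: gP.
by rewrite ltNge (dU _ (ltn_ord (g i)) _ _ (gP i) Uj).
Qed.

Lemma cos_natpi {R : realType} (n : nat) : cos (pi * n%:R) = (-1) ^+ n :> R.
Proof.
elim: n => [|n IH]; first by rewrite mulr0 cos0.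
by rewrite -natr1 mulrDr mulr1 cosDpi IH exprS mulN1r.
Qed.

(** At [t = n^(-p)] the phase is [n pi] and [1 - ln t = 1 + p ln n]. *)
Lemma chirp_peak {R : realType} (p : R) (n : nat) : 0 < p -> (0 < n)%N ->
  chirp p (n%:R `^ (- p)) =
  n%:R `^ (- p) * (1 + p * ln n%:R)^-1 ^+ 2 * (-1) ^+ n.
Proof.
move=> p0 n0; rewrite /chirp /logw ln_powR mulNr opprK -powRrM.
by rewrite mulrNN divff ?gt_eqF// powRr1// cos_natpi.
Qed.

(** After division by [(x + 1)^(-p)] the claim reads [1/(x + 1) <= (1 + 1/x)^p - 1], and the right
    side is at least [1/x]. It separates neighbouring branches of the chirp. *)
Lemma powRN_gap {R : realType} (p x : R) : 1 <= p -> 0 < x ->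
  (x + 1) `^ (- p - 1) <= x `^ (- p) - (x + 1) `^ (- p).
Proof.
move=> p1 x0; have y0 : 0 < x + 1 by rewrite addr_gt0.
rewrite powRB ?(gt_eqF y0) ?implybT// powRr1 ?(ltW y0)//.
have -> : x `^ (- p) = (x + 1) `^ (- p) * ((x + 1) / x) `^ p.
  rewrite powRM ?(ltW y0) ?invr_ge0 ?(ltW x0)// mulrA -powRD ?addNr ?powRr0 ?mul1r.
    by rewrite -powR_inv1 ?(ltW x0)// -powRrM mulN1r.
  by rewrite eqxx/= gt_eqF.
rewrite -[X in _ - X]mulr1 -mulrBr ler_wpM2l ?powR_ge0//.
have : (x + 1) / x <= ((x + 1) / x) `^ p.
  by rewrite le1r_powR// ler_pdivlMr// mul1r lerDl.
have : (x + 1)^-1 <= x^-1 by rewrite lef_pV2 ?posrE// lerDl.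
have -> : (x + 1) / x = 1 + x^-1 by rewrite mulrDl divff ?gt_eqF// mul1r.
lra.
Qed.

(** The chirp is nonpositive at the odd end, where the cosine is -1, so the intermediate value
    theorem reaches every height between 0 and the value at the even end. *)
Lemma chirp_branch {R : realType} (p y : R) (i : nat) : 0 < p -> (0 < i)%N ->
  0 <= y <= chirp p (i.*2%:R `^ (- p)) ->
  exists s, i.*2.+1%:R `^ (- p) <= s <= i.*2%:R `^ (- p) /\ chirp p s = y.
Proof.
move=> p0 i0 /andP[y0 yle].
have i20 : (0 : R) < i.*2%:R by rewrite ltr0n double_gt0.
have le1 : i.*2%:R `^ (- p) <= 1 :> R.
  rewrite powRN invf_le1 ?powR_gt0// -[leLHS](powRr0 i.*2%:R) ler_powR ?(ltW p0)//.
  by rewrite ler1n double_gt0.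
have lei : i.*2.+1%:R `^ (- p) <= i.*2%:R `^ (- p) :> R.
  by rewrite !powRN lef_pV2 ?posrE ?powR_gt0// ge0_ler_powR ?nnegrE ?ltW// ltr_nat.
have neg : chirp p (i.*2.+1%:R `^ (- p)) <= 0.
  rewrite chirp_peak// -signr_odd/= odd_double/= expr1 mulrN1 oppr_le0.
  by rewrite mulr_ge0 ?powR_ge0 ?sqr_ge0.
have cf : {within `[i.*2.+1%:R `^ (- p), i.*2%:R `^ (- p)]%classic,
    continuous (chirp p)}.
  apply: (continuous_subspaceW _ (@continuous_chirp R p)).
  move=> x /=; rewrite !in_itv/= => /andP[xl xr].
  by rewrite (le_trans xr le1) (le_trans (powR_ge0 _ _) xl).
have [|s] := IVT lei cf (v := y).
  apply/andP; split; first by rewrite ge_min; apply/orP; left; exact: le_trans neg y0.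
  by rewrite le_max; apply/orP; right.
by rewrite in_itv/= => ? <-; exists s.
Qed.

(** On each of the [n] branches with index [n + i], [i < n], one point is chosen at every height
    [2 r j] up to [h]. Different heights differ by at least [2 r]; equal heights on different
    branches are more than [r] apart horizontally. *)
Lemma chirp_covN_ge {R : realType} (p r : R) (n : nat) : 1 < p -> (0 < n)%N ->
  0 < r < (4 * n)%:R `^ (- p - 1) ->
  ((n%:R * ((4 * n)%:R `^ (- p) * (1 + p * ln (4 * n)%:R)^-1 ^+ 2 / (2 * r)))%:E <=
   covN (disc (0, chirp p 0)%R (n%:R `^ (- p))%R `&` graph01 (chirp p)) r)%E.
Proof.
move=> p1 n0 /andP[r0 rlt]; have p0 : 0 < p by lra.
(* [h] is a common lower bound for the peaks at [(2i)^(-p)] with [2i <= 4n]. *)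
set h := _ * _ ^+ 2.
have r20 : 0 < 2 * r by lra.
have powN (a b : nat) : (0 < a)%N -> (a <= b)%N -> b%:R `^ (- p) <= a%:R `^ (- p) :> R.
  move=> a0 ab; have b0 : (0 < b)%N by exact: leq_trans ab.
  by rewrite !powRN lef_pV2 ?posrE ?powR_gt0 ?ltr0n//
    ge0_ler_powR ?nnegrE ?(ltW p0) ?ler_nat.
have peak i : (0 < i)%N -> (i.*2 <= 4 * n)%N -> h <= chirp p (i.*2%:R `^ (- p)).
  move=> i0 i4; rewrite chirp_peak// ?double_gt0// -signr_odd odd_double expr0 mulr1.
  have i20 : (0 < i.*2)%N by rewrite double_gt0.
  have l1 : 0 <= ln i.*2%:R :> R by rewrite ln_ge0// ler1n.
  have l2 : ln i.*2%:R <= ln (4 * n)%:R :> R.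
    by rewrite ler_ln ?posrE ?ltr0n ?ler_nat// (leq_trans i20).
  have q1 : 0 < 1 + p * ln i.*2%:R by rewrite ltr_wpDr// mulr_ge0// ltW.
  have q2 : 1 + p * ln i.*2%:R <= 1 + p * ln (4 * n)%:R by rewrite lerD2l ler_wpM2l// ltW.
  have q3 := lt_le_trans q1 q2.
  rewrite /h ler_pM ?powR_ge0 ?sqr_ge0 ?powN//.
  by rewrite lerXn2r ?nnegrE ?invr_ge0 ?(ltW q1) ?(ltW q3)// lef_pV2.
have h0 : 0 <= h by rewrite /h mulr_ge0 ?powR_ge0 ?sqr_ge0.
(* The successor counts the height 0, which makes [K >= h / (2 r)]. *)
pose K := (Num.truncn (h / (2 * r))).+1.
have pt (ij : 'I_n * 'I_K) : exists w : R * R,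
    [/\ (n + ij.1).*2.+1%:R `^ (- p) <= w.1, w.1 <= (n + ij.1).*2%:R `^ (- p),
        w.2 = 2 * r * ij.2%:R & chirp p w.1 = w.2].
  case: ij => i j /=.
  have ni0 : (0 < n + i)%N by rewrite addn_gt0 n0.
  have y01 : 0 <= 2 * r * j%:R <= chirp p ((n + i).*2%:R `^ (- p)).
    rewrite mulr_ge0 ?(ltW r20)//=; apply: (@le_trans _ _ h).
      rewrite -ler_pdivlMl// mulrC -truncn_ge_nat ?divr_ge0 ?(ltW r20)//.
      by rewrite -ltnS ltn_ord.
    by apply: peak => //; have := ltn_ord i; lia.
  have [s [/andP[s1 s2] sE]] := chirp_branch p0 ni0 y01.
  by exists (s, 2 * r * j%:R).
have /choice[P PE] := pt.
(* Branch [j] lies to the left of [(2(n+i)+2)^(-p)], so the gap estimate at [x = 2(n+i)+1] applies;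
   since [i < j < n], [2(n+i)+2 <= 4n] and the gap is at least [(4n)^(-p-1) > r]. *)
have sep1 (i j : 'I_n) (u v : R) : (i < j)%N ->
    (n + i).*2.+1%:R `^ (- p) <= u -> v <= (n + j).*2%:R `^ (- p) -> r < `|u - v|.
  move=> ij u1 v1; apply: lt_le_trans (ler_norm _); apply: (lt_le_trans rlt).
  apply: (@le_trans _ _ ((n + i).*2.+2%:R `^ (- p - 1))).
    rewrite -opprD !(powRN _ (p + 1)) lef_pV2 ?posrE ?powR_gt0 ?ltr0n//; last by lia.
    rewrite ge0_ler_powR ?nnegrE//; first by lra.
    by rewrite ler_nat; have := ltn_ord j; lia.
  have := @powRN_gap _ p (n + i).*2.+1%:R (ltW p1); rewrite ltr0n natr1 => /(_ isT).
  have : (n + j).*2%:R `^ (- p) <= (n + i).*2.+2%:R `^ (- p) :> R.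
    by apply: powN => //; lia.
  lra.
have sepP a b : a != b -> r < edist (P a) (P b).
  have [a1 a2 a3 _] := PE a; have [b1 b2 b3 _] := PE b.
  have [eq2|ne2] := eqVneq a.2 b.2.
    move=> ne; apply: lt_le_trans (normB1_le_edist _ _).
    have : a.1 != b.1.
      by apply: contra ne => /eqP eq1;
        rewrite [a]surjective_pairing [b]surjective_pairing eq1 eq2.
    rewrite -val_eqE neq_ltn => /orP[ab|ba]; first exact: sep1 ab a1 b2.
    by rewrite distrC; exact: sep1 ba b1 a2.
  move=> _; apply: lt_le_trans (normB2_le_edist _ _).
  rewrite a3 b3 -mulrBr normrM (gtr0_norm r20).
  suff : (1 : R) <= `|a.2%:R - b.2%:R|.
    by move=> /(ler_wpM2l (ltW r20)); lra.
  move: ne2; rewrite -val_eqE neq_ltn => /orP[ab|ba]; first rewrite distrC.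
    by apply: le_trans (ler_norm _); rewrite lerBrDr addrC natr1 ler_nat.
  by apply: le_trans (ler_norm _); rewrite lerBrDr addrC natr1 ler_nat.
have FP a : (disc (0, chirp p 0) (n%:R `^ (- p)) `&` graph01 (chirp p)) (P a).
  have [a1 a2 a3 a4] := PE a.
  have w0 : 0 <= (P a).1 by exact: le_trans (powR_ge0 _ _) a1.
  have w2n : (P a).1 <= n.*2%:R `^ (- p).
    by apply: (le_trans a2); apply: powN; rewrite ?double_gt0// leq_double leq_addr.
  (* As [|chirp p t| <= t], a point of the graph is within twice its abscissa of the origin;
     [(2n)^(-p) <= n^(-p) / 2] then puts it in the disc. *)
  have w12 : 2 * (P a).1 <= n%:R `^ (- p).
    apply: (@le_trans _ _ (2 * n.*2%:R `^ (- p))); first by rewrite ler_wpM2l.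
    rewrite -mul2n natrM powRM// mulrA ler_piMl ?powR_ge0//.
    by rewrite powRN ler_pdivrMr ?powR_gt0// mul1r le1r_powR ?ler1n// ltW.
  have n1 : n%:R `^ (- p) <= 1 :> R.
    by have := powN 1%N n isT n0; rewrite powR1.
  have w1 : (P a).1 <= 1 by lra.
  split; last by exists (P a).1; rewrite w0 w1 a4 -surjective_pairing.
  have /(chirp_le p) : 0 <= (P a).1 <= 1 by rewrite w0.
  rewrite a4 => c; apply: (le_trans (edist_le_add _ _)).
  rewrite /= chirp0 !sub0r !normrN (ger0_norm w0); lra.
apply: le_trans (covN_ge_separated FP sepP).
have tr : h / (2 * r) <= K%:R by rewrite ltW// truncnS_gt.
by rewrite lee_fin card_prod !card_ord natrM ler_wpM2l.
Qed.

(** * Comparison of exponents *)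

Lemma ln_le_powR {R : realType} (d x : R) : 0 < d -> 1 <= x -> ln x <= x `^ d / d.
Proof.
move=> d0 x1; rewrite ler_pdivlMr// mulrC -ln_powR ltW// ln_sublinear//.
by rewrite powR_gt0// (lt_le_trans ltr01).
Qed.

Lemma powR_unbounded {R : realType} (e B : R) : 0 < e ->
  exists N : nat, forall n, (N <= n)%N -> B < n%:R `^ e.
Proof.
move=> e0; exists (Num.truncn (`|B| `^ e^-1)).+1 => n Nn.
apply: (le_lt_trans (ler_norm B)).
have h : `|B| `^ e^-1 < n%:R by rewrite (lt_le_trans (truncnS_gt _))// ler_nat.
have -> : `|B| = (`|B| `^ e^-1) `^ e.
  by rewrite -powRrM mulVf ?gt_eqF// powRr1.
by rewrite gt0_ltr_powR// nnegrE ?powR_ge0// (le_trans (powR_ge0 _ _) (ltW h)).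
Qed.

(** If [gamma < g0], the two bounds on the covering number at [rho = n^(-p)], [r = rho^(1/theta)]
    give [n^D <= 2 * 4^p * C * l^2] with [D > 0] and [l] logarithmic in [n], which fails for large
    [n]. *)
Lemma chirp_exponent_ge {R : realType} (p theta gamma C : R) :
  1 < p -> 0 < theta -> theta < p / (p + 1) ->
  (forall (r rho : R) (z : R * R),
    0 < r -> 0 < rho -> r <= rho `^ theta^-1 -> rho `^ theta^-1 < rho ->
    rho < 1 -> graph01 (chirp p) z ->
    (covN (disc z rho `&` graph01 (chirp p)) r <= (C * (rho / r) `^ gamma)%:E)%E) ->
  1 + theta / ((1 - theta) * p) <= gamma.
Proof.
move=> p1 th0 thp H; have p0 : 0 < p by lra.
have thp1 : theta * (p + 1) < p by rewrite -ltr_pdivlMr//; lra.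
have th1 : theta < 1 by nra.
set g0 := 1 + _; rewrite leNgt; apply/negP => gg0.
pose D := p * (theta^-1 - 1) * (g0 - gamma).
have thV : 1 < theta^-1 by rewrite invf_gt1.
have D0 : 0 < D by rewrite !mulr_gt0// subr_gt0.
(* This is the hypothesis [theta < p/(p+1)] rewritten; it lets [r = n^(-p/theta)] fall below the
   branch gap [(4n)^(-p-1)]. *)
have e0 : 0 < p / theta - (p + 1) by rewrite subr_gt0 ltr_pdivlMr// mulrC.
(* With [l <= A n^d], the square [l^2] costs [n^(2d) = n^(D/2)], only half of the available power
   [n^D]. *)
pose d := D / 4; have d0 : 0 < d by rewrite divr_gt0.
pose A := (1 + p / d) * 4 `^ d.
pose B := 2 * 4 `^ p * `|C| * A ^+ 2.
have [N1 HN1] := powR_unbounded (4 `^ (p + 1)) e0.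
have [N2 HN2] := @powR_unbounded R (D / 2) B (divr_gt0 D0 (ltr0n _ 2)).
(* [N1] makes [r] smaller than the branch gap, [N2] gives the final contradiction, and [2] ensures
   [n > 1], hence [r < rho < 1]. *)
pose n := (N1 + N2 + 2)%N.
have n2 : (1 < n)%N by rewrite /n addn2.
have n0 : (0 < n)%N by exact: ltnW.
have nR0 : 0 < n%:R :> R by rewrite ltr0n.
have nR1 : 1 < n%:R :> R by rewrite ltr1n.
have nN1 : 4 `^ (p + 1) < n%:R `^ (p / theta - (p + 1)).
  by apply: HN1; rewrite /n -addnA leq_addr.
have nN2 : B < n%:R `^ (D / 2) by apply: HN2; rewrite /n addnAC leq_addl.
have powS (a b : R) : n%:R `^ (a + b) = n%:R `^ a * n%:R `^ b.
  by rewrite powRD// (gt_eqF nR0) implybT.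
have n_gt0 a : 0 < n%:R `^ a :> R by exact: powR_gt0.
have nlt (a b : R) : a < b -> n%:R `^ a < n%:R `^ b.
  by move=> ab; rewrite /powR (gt_eqF nR0) ltr_expR ltr_pM2r// ln_gt0.
pose rho : R := n%:R `^ (- p); pose r : R := n%:R `^ (- (p / theta)).
have rE : rho `^ theta^-1 = r by rewrite /rho /r -powRrM mulNr.
have rrho : r < rho by rewrite nlt// ltrN2 ltr_pdivlMr// gtr_pMr.
have rho1 : rho < 1 by rewrite -(powRr0 (n%:R : R)) nlt// oppr_lt0.
have rsmall : 0 < r < (4 * n)%:R `^ (- p - 1).
  rewrite n_gt0/= natrM powRM// /r.
  have -> : - (p / theta) = - (p / theta - (p + 1)) + (- p - 1) by ring.
  have -> : 4 `^ (- p - 1) = (4 `^ (p + 1))^-1 :> R by rewrite -opprD powRN.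
  rewrite powS (ltr_pM2r (n_gt0 _)) powRN.
  have h4 : 0 < 4 `^ (p + 1) :> R by exact: powR_gt0.
  by rewrite (ltf_pV2 (n_gt0 _) h4).
have z0 : graph01 (chirp p) (0, chirp p 0) by exists 0; rewrite lexx ler01.
have ub := H r rho (0, chirp p 0) (n_gt0 _) (n_gt0 _).
rewrite rE lexx in ub; have {}ub := ub isT rrho rho1 z0.
have := le_trans (chirp_covN_ge p1 n0 rsmall) ub; rewrite lee_fin => {ub} bnd.
have n41 : 1 <= (4 * n)%:R :> R by rewrite ler1n muln_gt0.
set l := 1 + p * ln (4 * n)%:R in bnd.
have l1 : 1 <= l by rewrite lerDl mulr_ge0 ?ln_ge0// ltW.
have lA : l <= A * n%:R `^ d.
  rewrite /A -mulrA -powRM// -natrM mulrDl mul1r lerD//.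
    by rewrite -[leLHS](powRr0 (4 * n)%:R) ler_powR ?(ltW d0).
  by rewrite mulrAC -mulrA ler_wpM2l ?(ltW p0)// ln_le_powR.
have l2 : l ^+ 2 <= A ^+ 2 * n%:R `^ (D / 2).
  have -> : D / 2 = d + d by rewrite /d; lra.
  rewrite powS -expr2 -exprMn lerXn2r ?nnegrE// (le_trans ler01)//.
  exact: le_trans lA.
have l20 : 0 < l ^+ 2 by rewrite exprn_gt0// (lt_le_trans ltr01).
have rhoVr : rho / r = n%:R `^ (p * (theta^-1 - 1)).
  by rewrite /rho /r -powRN -powS; congr (_ `^ _); ring.
have lhsE : n%:R * ((4 * n)%:R `^ (- p) * l^-1 ^+ 2 / (2 * r)) =
    n%:R `^ D * (rho / r) `^ gamma / (2 * 4 `^ p * l ^+ 2).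
  rewrite natrM powRM// [4 `^ (- p)]powRN rhoVr -powRrM -powS.
  (* The left side equals [p (1/theta - 1) g0], which is the power of [n] in [n rho / r]: this is
     where the value of [g0] comes from. *)
  have -> : D + p * (theta^-1 - 1) * gamma = 1 + (- p + p / theta).
    rewrite /D /g0; field; rewrite !gt_eqF// subr_gt0//.
  rewrite !powS powRr1 ?(ltW nR0)// /r (powRN _ (p / theta)).
  field; rewrite !gt_eqF ?powR_gt0//; exact: lt_le_trans l1.
rewrite lhsE in bnd.
have g_gt0 : 0 < (rho / r) `^ gamma by rewrite rhoVr powR_gt0.
have c0 : 0 < 2 * 4 `^ p * l ^+ 2 by rewrite mulr_gt0// mulr_gt0// powR_gt0.
move: bnd; rewrite ler_pdivrMr// mulrAC ler_pM2r// => bnd.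
have : n%:R `^ D <= B * n%:R `^ (D / 2).
  apply: (le_trans bnd); rewrite /B.
  have -> : 2 * 4 `^ p * `|C| * A ^+ 2 * n%:R `^ (D / 2) =
    `|C| * (2 * 4 `^ p * (A ^+ 2 * n%:R `^ (D / 2))) by ring.
  apply: (le_trans (ler_wpM2r (ltW c0) (ler_norm C))).
  by rewrite ler_wpM2l// ler_wpM2l// mulr_ge0// powR_ge0.
have -> : n%:R `^ D = n%:R `^ (D / 2) * n%:R `^ (D / 2) :> R by rewrite -powS -splitr.
by rewrite ler_pM2r// leNgt nN2.
Qed.

(** * The dimension formula *)

Theorem theorem1p4 (R : realType) (p : R) :
  1 < p ->
  exists f : R -> R, W1p01 p f /\
    forall theta : R, 0 < theta -> theta < p / (p + 1) ->
      assouad_reg theta (graph01 f) = (1 + theta / ((1 - theta) * p))%:E.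
Proof.
move=> p1; exists (chirp p); split; first exact: W1p01_chirp.
move=> theta th0 thp; have p0 : 0 < p by lra.
have th1 : theta < 1 by apply: lt_trans thp _; rewrite ltr_pdivrMr; lra.
apply/eqP; rewrite eq_le; apply/andP; split.
  (* The claimed value is itself an admissible exponent, so the infimum is attained. *)
  apply: ereal_inf_lbound; exists (1 + theta / ((1 - theta) * p)) => //; split.
    by rewrite addr_gt0// divr_gt0// mulr_gt0// subr_gt0.
  by apply: chirp_covN_le => //; rewrite th0.
apply/ereal_infP => _ [gamma [_ [C [_ HC]]] <-].
by rewrite lee_fin; exact: chirp_exponent_ge HC.
Qed.
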